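(* Let $f:\mathbb{R}^3\to\mathbb{R}$ be a harmonic function and let $b>1$ be a real number. Then the product $(x^2+by^2-(b+1)z^2)\cdot f(x,y,z)$ is harmonic on $\mathbb{R}^3$ if and only if there exist $\alpha,\beta\in\mathbb{R}$ such that $f(x,y,z)=\alpha+\beta xyz$ for all $(x,y,z)\in\mathbb{R}^3$. *)

(* Defs.v *)
From Stdlib Require Import Reals.
From Coquelicot Require Import Coquelicot.
Open Scope R_scope.

Definition R3 : Type := (R * R * R)%type.

Inductive axis : Set := axis_x | axis_y | axis_z.

Definition coord (i : axis) (p : R3) : R :=
  let '(x, y, z) := p in
  match i with axis_x => x | axis_y => y | axis_z => z end.

Definition set_coord (i : axis) (p : R3) (t : R) : R3 :=
  let '(x, y, z) := p in
  match i with
  | axis_x => (t, y, z)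
  | axis_y => (x, t, z)
  | axis_z => (x, y, t)
  end.

Definition ex_partial (i : axis) (f : R3 -> R) (p : R3) : Prop :=
  ex_derive (fun t => f (set_coord i p t)) (coord i p).

(* [Derive] is total: the value is meaningful only under [ex_partial i f p]. *)
Definition partial (i : axis) (f : R3 -> R) (p : R3) : R :=
  Derive (fun t => f (set_coord i p t)) (coord i p).

(* Continuity is joint continuity on R^3, for the product uniform structure. *)
Fixpoint class_C (n : nat) (f : R3 -> R) : Prop :=
  match n with
  | O => forall p : R3, continuous f p
  | S m =>
      (forall p : R3, continuous f p) /\
      forall i : axis, (forall p : R3, ex_partial i f p) /\ class_C m (partial i f)
  end.

Definition laplacian (f : R3 -> R) (p : R3) : R :=
  partial axis_x (partial axis_x f) p
  + partial axis_y (partial axis_y f) p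
  + partial axis_z (partial axis_z f) p.

Definition harmonic (f : R3 -> R) : Prop :=
  class_C 2 f /\ forall p : R3, laplacian f p = 0.

(* Main.v *)
(** Write [q = x^2 + b y^2 - (b+1) z^2] and let [X = x d_x + b y d_y - (b+1) z d_z].
    Since [q] is harmonic, [laplacian (q f) = 4 X f], so [q f] is harmonic iff [f] is
    invariant under the flow of [X], which consists of the diagonal maps
    [diag (e^t, e^(b t), e^(-(b+1) t))].  Differentiating this invariance twice,
    harmonicity of [f] along a flow line reads
    [e^(-2 t) f_xx + e^(-2 b t) f_yy + e^(2 (b+1) t) f_zz = 0] for all [t], with the
    second derivatives taken at a fixed point.  The three rates are distinct, so
    [f_xx = f_yy = f_zz = 0] and [f] is affine in each variable; among the eight
    multiaffine monomials only [1] and [x y z] are annihilated by [X]. *)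

Require Import Defs.
From Stdlib Require Import Reals Lra FunctionalExtensionality.
From Coquelicot Require Import Coquelicot.
Open Scope R_scope.

(** * The chain rule along curves in space *)

Lemma is_derive_comp_2 (h dh : R -> R -> R) (u v : R -> R) (t du dv dy : R) :
  (forall x y, is_derive (fun x => h x y) x (dh x y)) ->
  continuous (fun p : R * R => dh (fst p) (snd p)) (u t, v t) ->
  is_derive (h (u t)) (v t) dy ->
  is_derive u t du -> is_derive v t dv ->
  is_derive (fun s => h (u s) (v s)) t (du * dh (u t) (v t) + dv * dy).
Proof.
intros Hx Hc Hy Hu Hv.
eapply filterdiff_ext_lin.
- apply (filterdiff_comp'_2 u v h t _ _
    (fun x y => plus (scal x (dh (u t) (v t))) (scal y dy)) Hu Hv).
  apply (is_derive_filterdiff h (u t) (v t) dh dy); trivial.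
  apply filter_forall; intros p; apply Hx.
- intros y; unfold scal, plus; simpl; unfold mult; simpl; ring.
Qed.

Lemma continuous_triple {U : UniformSpace} (u v w : U -> R) (s : U) :
  continuous u s -> continuous v s -> continuous w s ->
  continuous (fun r => (u r, v r, w r) : R3) s.
Proof.
intros Hu Hv Hw.
apply (continuous_comp_2 (fun r => (u r, v r)) w (fun p z => (p, z))); trivial.
- apply (continuous_comp_2 u v (fun x y => (x, y))); trivial.
  apply (continuous_ext (fun p => p)); [now intros []|apply continuous_id].
- apply (continuous_ext (fun p => p)); [now intros []|apply continuous_id].
Qed.

Lemma is_derive_partial i f p :
  ex_partial i f p ->
  is_derive (fun t => f (set_coord i p t)) (coord i p) (partial i f p).
Proof. exact (Derive_correct _ _). Qed.

(** The two-variable rule is used twice: on [y] and [z] with [x] frozen, then on [x] against the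
    parameter [s] itself. The second use works because [is_derive_comp_2] asks of its second slot
    only a derivative at one point, which [Hyz] supplies. *)
Lemma is_derive_comp_R3 (f : R3 -> R) (u v w : R -> R) (t du dv dw : R) :
  class_C 1 f -> is_derive u t du -> is_derive v t dv -> is_derive w t dw ->
  is_derive (fun s => f (u s, v s, w s)) t
    (du * partial axis_x f (u t, v t, w t)
     + dv * partial axis_y f (u t, v t, w t)
     + dw * partial axis_z f (u t, v t, w t)).
Proof.
intros [_ Hf] Hu Hv Hw.
assert (Cu : continuous u t) by (apply (ex_derive_continuous u); now exists du).
assert (Cv : continuous v t) by (apply (ex_derive_continuous v); now exists dv).
assert (Cw : continuous w t) by (apply (ex_derive_continuous w); now exists dw).
assert (Hyz : is_derive (fun s => f (u t, v s, w s)) t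
   (dv * partial axis_y f (u t, v t, w t) + dw * partial axis_z f (u t, v t, w t))).
{ apply (is_derive_comp_2 (fun y z => f (u t, y, z))
           (fun y z => partial axis_y f (u t, y, z)) v w); trivial.
  - intros y z; apply (is_derive_partial axis_y f (u t, y, z)), Hf.
  - apply (continuous_comp (fun p : R * R => (u t, fst p, snd p)) (partial axis_y f)).
    + apply continuous_triple;
        [apply continuous_const|apply continuous_fst|apply continuous_snd].
    + apply Hf.
  - apply (is_derive_partial axis_z f (u t, v t, w t)), Hf. }
replace (_ + _) with (du * partial axis_x f (u t, v t, w t) + 1 *
   (dv * partial axis_y f (u t, v t, w t) + dw * partial axis_z f (u t, v t, w t)))
  by ring.
apply (is_derive_comp_2 (fun x s => f (x, v s, w s))
         (fun x s => partial axis_x f (x, v s, w s)) u (fun s => s)); trivial.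
- intros x s; apply (is_derive_partial axis_x f (x, v s, w s)), Hf.
- apply (continuous_comp (fun p : R * R => (fst p, v (snd p), w (snd p)))
           (partial axis_x f)); [|apply Hf].
  apply continuous_triple; [apply continuous_fst| |];
    apply (continuous_comp snd); trivial; apply continuous_snd.
- exact (is_derive_id t).
Qed.

(** * Partial derivatives and stability of the classes [class_C n] *)

Lemma partial_is_derive i f p l :
  is_derive (fun t => f (set_coord i p t)) (coord i p) l -> partial i f p = l.
Proof. exact (is_derive_unique _ _ _). Qed.

Lemma set_coord_coord i p : set_coord i p (coord i p) = p.
Proof. now destruct i, p as [[x y] z]. Qed.

Lemma is_derive_partial_plus i f g p df dg :
  is_derive (fun t => f (set_coord i p t)) (coord i p) df ->
  is_derive (fun t => g (set_coord i p t)) (coord i p) dg ->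
  is_derive (fun t => f (set_coord i p t) + g (set_coord i p t)) (coord i p) (df + dg).
Proof. exact (is_derive_plus _ _ _ _ _). Qed.

Lemma is_derive_partial_mult i f g p df dg :
  is_derive (fun t => f (set_coord i p t)) (coord i p) df ->
  is_derive (fun t => g (set_coord i p t)) (coord i p) dg ->
  is_derive (fun t => f (set_coord i p t) * g (set_coord i p t)) (coord i p)
    (df * g p + f p * dg).
Proof.
intros Hf Hg.
generalize (is_derive_mult _ _ _ _ _ Hf Hg Rmult_comm).
now rewrite set_coord_coord.
Qed.

Lemma class_C_S n f : class_C (S n) f -> class_C n f.
Proof.
revert f; induction n as [|n IH]; intros f [Hc Hd]; [exact Hc|].
split; [exact Hc|intros i; destruct (Hd i) as [Hi Hi']; split; [exact Hi|now apply IH]].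
Qed.

Lemma class_C_continuous n f p : class_C n f -> continuous f p.
Proof. destruct n as [|n]; [|intros []]; trivial. Qed.

Lemma class_C_const n c : class_C n (fun _ => c).
Proof.
revert c; induction n as [|n IH]; intros c; [intros p; apply continuous_const|].
split; [intros p; apply continuous_const|intros i].
assert (Hd : forall p, is_derive (fun t => c) (coord i p) 0)
  by (intros p; exact (is_derive_const c _)).
split; [intros p; exists 0; apply Hd|].
rewrite (functional_extensionality (partial i _) (fun _ => 0)); [apply IH|].
intros p; apply partial_is_derive, Hd.
Qed.

Lemma continuous_coord i p : continuous (coord i) p.
Proof.
destruct p as [[x y] z], i.
- apply (continuous_ext (fun p : R3 => fst (fst p))); [now intros [[]]|].
  apply (continuous_comp fst fst); apply continuous_fst.
- apply (continuous_ext (fun p : R3 => snd (fst p))); [now intros [[]]|].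
  apply (continuous_comp fst snd); [apply continuous_fst|apply continuous_snd].
- apply (continuous_ext (fun p : R3 => snd p)); [now intros [[]]|].
  apply continuous_snd.
Qed.

Lemma class_C_coord n j : class_C n (coord j).
Proof.
destruct n as [|n]; [exact (continuous_coord j)|].
split; [exact (continuous_coord j)|intros i].
assert (Hd : exists c, forall p,
          is_derive (fun t => coord j (set_coord i p t)) (coord i p) c).
(* The constant is the Kronecker delta of [i] and [j]: [0] is tried first, with backtracking to
   [1]. *)
{ destruct i, j; (exists 0 + exists 1); intros [[x y] z]; simpl;
    solve [exact (is_derive_id _) | exact (is_derive_const _ _)]. }
destruct Hd as [c Hd].
split; [intros p; exists c; apply Hd|].
rewrite (functional_extensionality (partial i _) (fun _ => c));
  [apply class_C_const|].
intros p; apply partial_is_derive, Hd.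
Qed.

Lemma class_C_plus n f g :
  class_C n f -> class_C n g -> class_C n (fun p => f p + g p).
Proof.
revert f g; induction n as [|n IH]; intros f g Hf Hg;
  assert (Hc : forall p, continuous (fun p => f p + g p) p)
    by (intros p; apply (continuous_plus f g);
        eapply class_C_continuous; eassumption); [exact Hc|].
split; [exact Hc|intros i].
destruct Hf as [_ Hf], Hg as [_ Hg]; destruct (Hf i), (Hg i).
assert (Hd : forall p, is_derive (fun t => f (set_coord i p t) + g (set_coord i p t))
                (coord i p) (partial i f p + partial i g p))
  by (intros p; apply is_derive_partial_plus; apply is_derive_partial; trivial).
split; [intros p; eexists; apply Hd|].
rewrite (functional_extensionality (partial i _)
           (fun p => partial i f p + partial i g p));
  [now apply IH|].
intros p; apply partial_is_derive, Hd.
Qed.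

Lemma class_C_mult n f g :
  class_C n f -> class_C n g -> class_C n (fun p => f p * g p).
Proof.
revert f g; induction n as [|n IH]; intros f g Hf Hg;
  assert (Hc : forall p, continuous (fun p => f p * g p) p)
    by (intros p; apply (continuous_mult f g);
        eapply class_C_continuous; eassumption); [exact Hc|].
split; [exact Hc|intros i].
(* The Leibniz rule leaves [f] and [g] undifferentiated in one factor each, so the induction
   hypothesis needs them in class [n] too. *)
assert (Hf' := class_C_S _ _ Hf); assert (Hg' := class_C_S _ _ Hg).
destruct Hf as [_ Hf], Hg as [_ Hg]; destruct (Hf i), (Hg i).
assert (Hd : forall p, is_derive (fun t => f (set_coord i p t) * g (set_coord i p t))
                (coord i p) (partial i f p * g p + f p * partial i g p))
  by (intros p; apply is_derive_partial_mult; apply is_derive_partial; trivial).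
split; [intros p; eexists; apply Hd|].
rewrite (functional_extensionality (partial i _)
           (fun p => partial i f p * g p + f p * partial i g p));
  [apply class_C_plus; apply IH; trivial|].
intros p; apply partial_is_derive, Hd.
Qed.

(** * The quadratic form and the Laplacian of the product *)

Definition weight (b : R) (i : axis) : R :=
  match i with axis_x => 1 | axis_y => b | axis_z => - (b + 1) end.

(** Written uniformly in the axis, so that one Leibniz computation serves all three directions. *)
Definition quad (b : R) (p : R3) : R :=
  weight b axis_x * (coord axis_x p * coord axis_x p)
  + weight b axis_y * (coord axis_y p * coord axis_y p)
  + weight b axis_z * (coord axis_z p * coord axis_z p).

(** The field [X], half the gradient of [quad b]: the cross term of the Laplacian, twice the product
    of the gradients, is therefore [4 X f]. *)
Definition euler_field (b : R) (f : R3 -> R) (p : R3) : R :=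
  weight b axis_x * coord axis_x p * partial axis_x f p
  + weight b axis_y * coord axis_y p * partial axis_y f p
  + weight b axis_z * coord axis_z p * partial axis_z f p.

Lemma class_C_quad n b : class_C n (quad b).
Proof.
repeat first [apply (class_C_plus n (fun p => _ + _)) | apply class_C_plus];
  apply (class_C_mult n (fun _ => _)); try apply class_C_const;
  apply class_C_mult; apply class_C_coord.
Qed.

Lemma is_derive_quad b i p :
  is_derive (fun t => quad b (set_coord i p t)) (coord i p)
    (2 * weight b i * coord i p).
Proof.
destruct i, p as [[x y] z]; unfold quad; simpl; auto_derive; trivial; ring.
Qed.

Lemma is_derive_coord i p :
  is_derive (fun t => coord i (set_coord i p t)) (coord i p) 1.
Proof. destruct i, p as [[x y] z]; exact (is_derive_id _). Qed.

Lemma partial2_quad_mult b i f p :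
  class_C 2 f ->
  partial i (partial i (fun p => quad b p * f p)) p
  = 2 * weight b i * f p + 4 * (weight b i * coord i p * partial i f p)
    + quad b p * partial i (partial i f) p.
Proof.
intros [_ Hf]; destruct (Hf i) as [Hf1 [_ Hf2]]; destruct (Hf2 i) as [Hf3 _].
rewrite (functional_extensionality (partial i (fun p => quad b p * f p))
  (fun p => 2 * weight b i * coord i p * f p + quad b p * partial i f p)).
- apply partial_is_derive.
  replace (_ + _) with
    (((0 * coord i p + 2 * weight b i * 1) * f p
      + 2 * weight b i * coord i p * partial i f p)
     + (2 * weight b i * coord i p * partial i f p
        + quad b p * partial i (partial i f) p)) by ring.
  apply (is_derive_partial_plus i (fun p => 2 * weight b i * coord i p * f p)
           (fun p => quad b p * partial i f p)).
  + apply (is_derive_partial_mult i (fun p => 2 * weight b i * coord i p) f);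
      [|now apply is_derive_partial].
    apply (is_derive_partial_mult i (fun p => 2 * weight b i) (coord i));
      [exact (is_derive_const _ _)|apply is_derive_coord].
  + apply is_derive_partial_mult; [apply is_derive_quad|now apply is_derive_partial].
- intros r; apply partial_is_derive.
  apply is_derive_partial_mult; [apply is_derive_quad|now apply is_derive_partial].
Qed.

Lemma harmonic_quad_mult b f :
  harmonic f ->
  harmonic (fun p => quad b p * f p) <-> forall p, euler_field b f p = 0.
Proof.
intros [Hf Hl].
assert (L : forall p, laplacian (fun p => quad b p * f p) p = 4 * euler_field b f p).
{ intros p; assert (H := Hl p); unfold laplacian in *.
  rewrite !partial2_quad_mult by trivial.
  (* The terms [2 * weight b i * f p] cancel because the three weights sum to zero. *)
  transitivity (4 * euler_field b f p + quad b p *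
    (partial axis_x (partial axis_x f) p + partial axis_y (partial axis_y f) p
     + partial axis_z (partial axis_z f) p));
    [unfold euler_field; simpl; ring|rewrite H; ring]. }
split.
- intros [_ H] p; specialize (H p); rewrite L in H; lra.
- intros H; split; [apply class_C_mult; [apply class_C_quad|exact Hf]|].
  intros p; rewrite L, H; ring.
Qed.

(** * Invariance under the diagonal flow *)

Definition scale (l : axis -> R) (p : R3) : R3 :=
  (l axis_x * coord axis_x p, l axis_y * coord axis_y p, l axis_z * coord axis_z p).

Definition flow (b t : R) : R3 -> R3 := scale (fun i => exp (weight b i * t)).

(** The derivative of [f] along a flow line is [euler_field b f] at the current point, and the flow
    at time [0] is the identity. *)
Lemma flow_invariant b f :
  class_C 1 f -> (forall p, euler_field b f p = 0) ->
  forall t p, f (flow b t p) = f p.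
Proof.
intros Hf HX t p.
assert (Hd : forall s, is_derive (fun s => f (flow b s p)) s 0).
{ intros s; rewrite <- (HX (flow b s p)).
  assert (Hw : forall i, is_derive (fun s => exp (weight b i * s) * coord i p) s
            (weight b i * (exp (weight b i * s) * coord i p)))
    by (intros i; auto_derive; trivial; ring).
  apply (is_derive_comp_R3 f _ _ _ s _ _ _ Hf (Hw axis_x) (Hw axis_y) (Hw axis_z)). }
assert (H0 : flow b 0 p = p).
{ destruct p as [[x y] z]; unfold flow, scale; simpl.
  now rewrite !Rmult_0_r, exp_0, !Rmult_1_l. }
rewrite <- H0 at 2.
destruct (Rtotal_order t 0) as [H|[->|H]]; [|reflexivity|symmetry];
  apply (eq_is_derive (fun s => f (flow b s p))); trivial; intros s _; apply Hd.
Qed.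

Lemma partial_scale l i f p :
  ex_partial i f (scale l p) ->
  partial i (fun r => f (scale l r)) p = l i * partial i f (scale l p).
Proof.
intros H; apply partial_is_derive.
assert (Hl : is_derive (fun t => l i * t) (coord i p) (l i))
  by (auto_derive; trivial; ring).
destruct i, p as [[x y] z];
  exact (is_derive_comp _ _ _ _ _ (is_derive_partial _ _ _ H) Hl).
Qed.

(** Each differentiation of the invariance in direction [i] brings out one factor [l i]. *)
Lemma partial2_scale_invariant l i f p :
  class_C 2 f -> (forall r, f (scale l r) = f r) ->
  partial i (partial i f) p = l i * l i * partial i (partial i f) (scale l p).
Proof.
intros [_ Hf] Hl; destruct (Hf i) as [Hf1 [_ Hf2]]; destruct (Hf2 i) as [Hf3 _].
assert (H1 : forall r, partial i f r = l i * partial i f (scale l r)).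
{ intros r; rewrite <- partial_scale by apply Hf1.
  f_equal; apply functional_extensionality; intros; now rewrite Hl. }
rewrite (functional_extensionality (partial i f) _ H1) at 1.
(* The zero summand is the derivative of the constant factor [l i] in the product rule. *)
replace (l i * l i * _) with
  (0 * partial i f (scale l p) + l i * (l i * partial i (partial i f) (scale l p)))
  by ring.
apply partial_is_derive.
apply (is_derive_partial_mult i (fun _ => l i) (fun r => partial i f (scale l r)));
  [exact (is_derive_const _ _)|].
rewrite <- partial_scale by apply Hf3.
apply (is_derive_partial i (fun r => partial i f (scale l r))).
assert (Hd : ex_derive (fun t => l i * t) (coord i p)) by (auto_derive; trivial).
specialize (Hf3 (scale l p)).
destruct i, p as [[x y] z]; exact (ex_derive_comp _ _ _ Hf3 Hd).
Qed.

(** * Independence of exponentials and vanishing of the pure second derivatives *)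

Lemma exp_sum_derive A B C a b c :
  (forall t, A * exp (a * t) + B * exp (b * t) + C * exp (c * t) = 0) ->
  forall t, A * a * exp (a * t) + B * b * exp (b * t) + C * c * exp (c * t) = 0.
Proof.
intros H t.
assert (Hd : is_derive (fun t => A * exp (a * t) + B * exp (b * t) + C * exp (c * t)) t
   (A * a * exp (a * t) + B * b * exp (b * t) + C * c * exp (c * t)))
  by (auto_derive; trivial; ring).
rewrite <- (is_derive_unique _ _ _ Hd), <- (Derive_const 0 t).
now apply Derive_ext.
Qed.

(** The relation and its first two derivatives at [0] form a linear system in [A], [B], [C],
    invertible when the rates are distinct. *)
Lemma exp_lin_indep A B C a b c :
  a <> b -> a <> c -> b <> c ->
  (forall t, A * exp (a * t) + B * exp (b * t) + C * exp (c * t) = 0) ->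
  A = 0 /\ B = 0 /\ C = 0.
Proof.
intros Hab Hac Hbc H0.
assert (H1 := exp_sum_derive _ _ _ _ _ _ H0).
assert (H2 := exp_sum_derive _ _ _ _ _ _ H1 0).
specialize (H0 0); specialize (H1 0).
rewrite !Rmult_0_r, exp_0, !Rmult_1_r in H0, H1, H2.
(* Each product below is a Lagrange interpolation combination of the Vandermonde system. *)
repeat split.
- apply (Rmult_eq_reg_l ((a - b) * (a - c)));
    [|apply Rmult_integral_contrapositive; lra].
  transitivity ((A * a * a + B * b * b + C * c * c)
    - (b + c) * (A * a + B * b + C * c) + b * c * (A + B + C)); [ring|].
  rewrite H0, H1, H2; ring.
- apply (Rmult_eq_reg_l ((b - a) * (b - c)));
    [|apply Rmult_integral_contrapositive; lra].
  transitivity ((A * a * a + B * b * b + C * c * c)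
    - (a + c) * (A * a + B * b + C * c) + a * c * (A + B + C)); [ring|].
  rewrite H0, H1, H2; ring.
- apply (Rmult_eq_reg_l ((c - a) * (c - b)));
    [|apply Rmult_integral_contrapositive; lra].
  transitivity ((A * a * a + B * b * b + C * c * c)
    - (a + b) * (A * a + B * b + C * c) + a * b * (A + B + C)); [ring|].
  rewrite H0, H1, H2; ring.
Qed.

Lemma partial2_eq_0 b f :
  1 < b -> harmonic f -> (forall p, euler_field b f p = 0) ->
  forall i p, partial i (partial i f) p = 0.
Proof.
intros hb [Hf Hl] HX i p.
(* The factor [exp (weight b j * t)] squared from the invariance is moved to the other side, hence
   the rate [-2 * weight b j]. *)
assert (HF : forall t j, partial j (partial j f) (flow b t p)
          = partial j (partial j f) p * exp (-2 * weight b j * t)).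
{ intros t j.
  rewrite (partial2_scale_invariant (fun i => exp (weight b i * t)) j f p Hf)
    by (apply flow_invariant; trivial; now apply class_C_S).
  fold (flow b t); rewrite <- exp_plus, Rmult_comm, <- Rmult_assoc, <- exp_plus.
  replace (_ + _) with 0 by ring; rewrite exp_0; ring. }
(* The rates are [-2], [-2 b] and [2 (b + 1)]: [1 < b] separates the first two, and the third has
   the opposite sign. *)
destruct (exp_lin_indep (partial axis_x (partial axis_x f) p)
   (partial axis_y (partial axis_y f) p) (partial axis_z (partial axis_z f) p)
   (-2 * weight b axis_x) (-2 * weight b axis_y) (-2 * weight b axis_z))
  as [Hx [Hy Hz]]; try (simpl; lra).
- intros t; rewrite <- !HF; apply Hl.
- now destruct i.
Qed.

(** * Functions affine in each variable and the kernel of the field *)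

Lemma Derive2_eq_0_affine (g : R -> R) :
  (forall x, ex_derive g x) -> (forall x, ex_derive (Derive g) x) ->
  (forall x, Derive (Derive g) x = 0) ->
  forall x, Derive g x = g 1 - g 0 /\ g x = g 0 + x * (g 1 - g 0).
Proof.
intros H1 H2 H3.
assert (Hconst : forall h : R -> R, (forall x, is_derive h x 0) -> forall x, h x = h 0).
{ intros h Hh x; destruct (Rtotal_order x 0) as [H|[->|H]]; [|reflexivity|symmetry];
    apply (eq_is_derive h); trivial; intros s _; apply Hh. }
assert (HD : forall x, Derive g x = Derive g 0).
{ apply Hconst; intros x; rewrite <- (H3 x); now apply Derive_correct. }
assert (Hg : forall x, g x = g 0 + x * Derive g 0).
{ intros x.
  (* Subtracting the linear part leaves a function of derivative [Derive g y - Derive g 0], which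
     [HD] makes zero. *)
  assert (H := Hconst (fun x => g x - x * Derive g 0)).
  cbv beta in H; rewrite Rmult_0_l in H.
  rewrite <- (Rminus_0_r (g 0)), <- (H) with (x := x); [ring|].
  intros y; rewrite <- (HD y); auto_derive; [apply H1|].
  change (Derive (fun x => g x) y) with (Derive g y); rewrite (HD y); ring. }
assert (H0 : Derive g 0 = g 1 - g 0) by (rewrite (Hg 1); ring).
intros x; rewrite HD, (Hg x), H0; split; ring.
Qed.

(** Expressing the slope by the values at [0] and [1] turns the differential equation for [f] into
    an algebraic one. *)
Lemma partial2_eq_0_affine i f p :
  class_C 2 f -> (forall r, partial i (partial i f) r = 0) ->
  partial i f p = f (set_coord i p 1) - f (set_coord i p 0) /\
  f p = f (set_coord i p 0) + coord i p * (f (set_coord i p 1) - f (set_coord i p 0)).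
Proof.
intros [_ Hf] H0; destruct (Hf i) as [Hf1 [_ Hf2]]; destruct (Hf2 i) as [Hf3 _].
replace (f p) with (f (set_coord i p (coord i p))) by now rewrite set_coord_coord.
apply (Derive2_eq_0_affine (fun t => f (set_coord i p t))); intros t;
  [generalize (Hf1 (set_coord i p t))|generalize (Hf3 (set_coord i p t))
  |generalize (H0 (set_coord i p t))];
  destruct i, p as [[x y] z]; exact (fun H => H).
Qed.

(** A function affine in each variable is determined by its values at the eight vertices of the unit
    cube, and [X f = 0] becomes a linear system in these values. *)
Lemma euler_field_eq_0 b f :
  1 < b -> harmonic f ->
  (forall p, euler_field b f p = 0) <->
  exists alpha beta, forall x y z, f (x, y, z) = alpha + beta * (x * y * z).
Proof.
intros hb Hf; split.
- intros HX.
  assert (Haff := fun i p =>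
    partial2_eq_0_affine i f p (proj1 Hf) (partial2_eq_0 b f hb Hf HX i)).
  assert (Ax := fun x y z => proj2 (Haff axis_x (x, y, z))).
  assert (Ay := fun x y z => proj2 (Haff axis_y (x, y, z))).
  assert (Az := fun x y z => proj2 (Haff axis_z (x, y, z))).
  assert (E : forall x y z,
    x * (f (1, y, z) - f (0, y, z)) + b * y * (f (x, 1, z) - f (x, 0, z))
    - (b + 1) * z * (f (x, y, 1) - f (x, y, 0)) = 0).
  { intros x y z; assert (H := HX (x, y, z)); unfold euler_field in H.
    rewrite !(fun i => proj1 (Haff i (x, y, z))) in H; simpl in H; lra. }
  simpl in Ax, Ay, Az.
  (* At each of these vertices the equation reduces, given the values already found, to a nonzero
     sum of weights times the difference with [f (0, 0, 0)]: [1], [b], [-(b + 1)], then [1 + b],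
     [-b], [-1]. *)
  assert (E100 := E 1 0 0); assert (E010 := E 0 1 0); assert (E001 := E 0 0 1).
  assert (E110 := E 1 1 0); assert (E101 := E 1 0 1); assert (E011 := E 0 1 1).
  assert (F100 : f (1, 0, 0) = f (0, 0, 0)) by lra.
  assert (F010 : f (0, 1, 0) = f (0, 0, 0)) by nra.
  assert (F001 : f (0, 0, 1) = f (0, 0, 0)) by nra.
  rewrite F100, F010, F001 in *.
  assert (F110 : f (1, 1, 0) = f (0, 0, 0)) by nra.
  assert (F101 : f (1, 0, 1) = f (0, 0, 0)) by nra.
  assert (F011 : f (0, 1, 1) = f (0, 0, 0)) by nra.
  (* At [(1, 1, 1)] the three weights sum to zero, so that value stays free and yields [beta]. *)
  exists (f (0, 0, 0)), (f (1, 1, 1) - f (0, 0, 0)); intros x y z.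
  (* Trilinear interpolation from the vertices, one variable at a time. *)
  rewrite Ax, (Ay 0), (Ay 1), (Az 0 0), (Az 0 1), (Az 1 0), (Az 1 1).
  rewrite F100, F010, F001, F110, F101, F011; ring.
- intros (al & be & H) [[x y] z].
  assert (Hx : partial axis_x f (x, y, z) = be * (y * z)).
  { apply partial_is_derive; simpl.
    apply (is_derive_ext (fun t => al + be * (t * y * z))); [now intros t; rewrite H|].
    auto_derive; trivial; ring. }
  assert (Hy : partial axis_y f (x, y, z) = be * (x * z)).
  { apply partial_is_derive; simpl.
    apply (is_derive_ext (fun t => al + be * (x * t * z))); [now intros t; rewrite H|].
    auto_derive; trivial; ring. }
  assert (Hz : partial axis_z f (x, y, z) = be * (x * y)).
  { apply partial_is_derive; simpl.
    apply (is_derive_ext (fun t => al + be * (x * y * t))); [now intros t; rewrite H|].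
    auto_derive; trivial; ring. }
  (* Each term is [be * (x * y * z)] times a weight, and the weights sum to zero. *)
  unfold euler_field; rewrite Hx, Hy, Hz; simpl; ring.
Qed.

Theorem theorem4 (f : R3 -> R) (b : R) (hf : harmonic f) (hb : 1 < b) :
  harmonic (fun '(x, y, z) => (x ^ 2 + b * y ^ 2 - (b + 1) * z ^ 2) * f (x, y, z))
  <-> exists alpha beta : R,
        forall x y z : R, f (x, y, z) = alpha + beta * (x * y * z).
Proof.
rewrite <- (euler_field_eq_0 b f hb hf), <- (harmonic_quad_mult b f hf).
(* The target function is left open; [reflexivity] identifies it with the product in the
   statement. *)
erewrite (functional_extensionality (fun p => quad b p * f p)); [reflexivity|].
intros [[x y] z]; unfold quad; simpl; ring.
Qed.
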